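(* Let $n\ge2$. For each $f^{(n)}\in\mathcal H_{\mathbb C}^{\otimes n}$ we have, for $\sigma^{\otimes n}$-a.e. $(t_1,\dots,t_n)$, $$(P_nf^{(n)})(t_1,\dots,t_n)=\frac 1{n!}\sum_{\pi\in S_n}Q_{\pi}(t_1,\dots,t_n)\, f^{(n)}(t_{\pi^{-1}(1)},\dots,t_{\pi^{-1}(n)}),$$ where for $\pi\in S_n$ $$Q_{\pi}(t_1,\dots,t_n):=\prod_{\substack{1\le i<j\le n\\ \pi(i)>\pi(j)}}Q(t_i,t_j).$$ In particular, for any $f_1,\dots,f_n\in\mathcal H_{\mathbb C}$, $$(f_1\circledast\dots\circledast f_n)(t_1,\dots,t_n)=\frac1{n!}\sum_{\pi\in S_n}Q_\pi(t_1,\dots,t_n)\,(f_{\pi(1)}\otimes\dots\otimes f_{\pi(n)})(t_1,\dots,t_n).$$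
   Context: $T$ is a locally compact Polish space with Borel $\sigma$-algebra $\mathcal B(T)$, and $\sigma$ is a Radon non-atomic measure on $T$. $A\in\mathcal B(T^2)$ is a symmetric set (i.e. $(s,t)\in A$ implies $(t,s)\in A$) containing the diagonal $\{(t,t)\mid t\in T\}$ and with $\sigma^{\otimes2}(A)=0$. Put $T^{(2)}:=T^2\setminus A$, and let $Q:T^{(2)}\to\{z\in\mathbb C: |z|=1\}$ be measurable and Hermitian: $Q(s,t)=\overline{Q(t,s)}$. Thus $Q$ is defined $\sigma^{\otimes 2}$-a.e. on $T^2$. $\mathcal H_{\mathbb C}:=L^2(T\to\mathbb C,\sigma)$, so $\mathcal H_{\mathbb C}^{\otimes n}=L^2(T^n\to\mathbb C,\sigma^{\otimes n})$. For $1\le j\le n-1$ define the unitary operator $\Psi_j$ on $\mathcal H_{\mathbb C}^{\otimes n}$ by $$(\Psi_jf^{(n)})(t_1,\dots,t_n):=Q(t_j,t_{j+1})f^{(n)}(t_1,\dots,t_{j-1},t_{j+1},t_j,t_{j+2},\dots,t_n).$$ For $\pi\in S_n$ write $\pi=\pi_{j_1}\dotsm\pi_{j_k}$ as a product of adjacent transpositions $\pi_j=(j,j+1)$ and set $\Psi_\pi:=\Psi_{j_1}\dotsm\Psi_{j_k}$; this does not depend on the chosen representation, and $\pi\mapsto\Psi_\pi$ is a unitary representation of $S_n$ (with $\pi\rho=\pi\circ\rho$). The $Q$-symmetrization operator is $P_n:=\frac1{n!}\sum_{\pi\in S_n}\Psi_\pi$, and $f_1\circledast\dots\circledast f_n:=P_n(f_1\otimes\dots\otimes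 f_n)$. *)

(* Defs.v *)
From HB Require Import structures.
From mathcomp Require Import all_boot all_order all_algebra fingroup perm.
From mathcomp Require Import generic_quotient ring_quotient complex.
From mathcomp Require Import all_classical all_reals all_analysis.
From mathcomp Require Import measurable_realfun ring lra.
Import Order.TTheory GRing.Theory Num.Theory.
Import numFieldNormedType.Exports.

Set Implicit Arguments.
Unset Strict Implicit.
Unset Printing Implicit Defensive.

Local Open Scope classical_set_scope.
Local Open Scope ring_scope.
Local Open Scope quotient_scope.

Section complex_L2.
Context d (X : measurableType d) (R : realType).
Implicit Types (D : set X) (f g : X -> R[i]).

Definition cmeasurable D f :=
  measurable_fun D (fun x => complex.Re (f x)) /\
  measurable_fun D (fun x => complex.Im (f x)).

(* |z|^2, as an element of R (the library's norm on R[i] is R[i]-valued) *)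
Definition sqmod (z : R[i]) : R := complex.Re z ^+ 2 + complex.Im z ^+ 2.

Lemma sqmod_ge0 z : 0 <= sqmod z.
Proof. by rewrite addr_ge0 ?sqr_ge0. Qed.

Lemma sqmodM z w : sqmod (z * w) = sqmod z * sqmod w.
Proof. case: z w => a b [c e]; rewrite /sqmod /=; ring. Qed.

Lemma cmeasurableM D f g : cmeasurable D f -> cmeasurable D g ->
  cmeasurable D (fun x => f x * g x).
Proof.
move=> [rf jf] [rg jg]; split.
- apply: (@eq_measurable_fun _ _ _ _ _ (fun x =>
    complex.Re (f x) * complex.Re (g x) - complex.Im (f x) * complex.Im (g x))).
    by move=> x _; case: (f x) (g x) => [? ?] [? ?].
  by apply: measurable_funB; exact: measurable_funM.
- apply: (@eq_measurable_fun _ _ _ _ _ (fun x =>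
    complex.Re (f x) * complex.Im (g x) + complex.Im (f x) * complex.Re (g x))).
    by move=> x _; case: (f x) (g x) => [? ?] [? ?].
  by apply: measurable_funD; exact: measurable_funM.
Qed.

Lemma cmeasurableD D f g : cmeasurable D f -> cmeasurable D g ->
  cmeasurable D (fun x => f x + g x).
Proof.
move=> [rf jf] [rg jg]; split.
- apply: (@eq_measurable_fun _ _ _ _ _ (fun x => complex.Re (f x) + complex.Re (g x))).
    by move=> x _; case: (f x) (g x) => [? ?] [? ?].
  exact: measurable_funD.
- apply: (@eq_measurable_fun _ _ _ _ _ (fun x => complex.Im (f x) + complex.Im (g x))).
    by move=> x _; case: (f x) (g x) => [? ?] [? ?].
  exact: measurable_funD.
Qed.

Lemma cmeasurable_cst D (c : R[i]) : cmeasurable D (fun=> c).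
Proof. by split; exact: measurable_cst. Qed.

Lemma measurable_sqmod D f : cmeasurable D f ->
  measurable_fun D (fun x => (sqmod (f x))%:E).
Proof.
move=> [rf jf]; apply/measurable_EFinP.
by apply: measurable_funD; exact: measurable_funX.
Qed.

Variable mu : {measure set X -> \bar R}.

Definition square_integrable f :=
  cmeasurable [set: X] f /\ (\int[mu]_x (sqmod (f x))%:E < +oo)%E.

Definition L2pred : {pred X -> R[i]} := fun f => `[< square_integrable f >].

Lemma L2pred_submod : submod_closed L2pred.
Proof.
split.
  apply/asboolP; split; first exact: cmeasurable_cst.
  rewrite integral0_eq ?ltry// => x _.
  by rewrite /sqmod/= expr0n/= addr0.
move=> a f g /asboolP[mf If] /asboolP[mg Ig]; apply/asboolP.
have mh : cmeasurable [set: X] (a *: f + g).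
  by apply: cmeasurableD => //; apply: cmeasurableM => //; exact: cmeasurable_cst.
split=> //.
have h x : sqmod ((a *: f + g) x) <= (sqmod a *+ 2) * sqmod (f x) + 2%:R * sqmod (g x).
  rewrite (_ : (a *: f + g) x = a * f x + g x)//
    (_ : sqmod a *+ 2 * _ = sqmod (a * f x) *+ 2); last first.
    by rewrite sqmodM mulrnAl.
  case: (a * f x) (g x) => u v [w z]; rewrite /sqmod /=.
  have := sqr_ge0 (u - w); have := sqr_ge0 (v - z); rewrite mulr2n; nra.
apply: (@le_lt_trans _ _ (\int[mu]_x
  ((sqmod a *+ 2)%:E * (sqmod (f x))%:E + 2%:E * (sqmod (g x))%:E)))%E.
  apply: ge0_le_integral => //.
  - by move=> x _; rewrite lee_fin sqmod_ge0.
  - exact: measurable_sqmod.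
  - by apply: emeasurable_funD; apply: measurable_funeM; exact: measurable_sqmod.
  - by move=> x _; rewrite -!EFinM -EFinD lee_fin h.
rewrite ge0_integralD//.
- rewrite !ge0_integralZl//.
  + apply: lte_add_pinfty; rewrite lte_mul_pinfty// lee_fin.
    by rewrite mulrn_wge0// sqmod_ge0.
  + exact: measurable_sqmod.
  + by move=> x _; rewrite lee_fin sqmod_ge0.
  + exact: measurable_sqmod.
  + by move=> x _; rewrite lee_fin sqmod_ge0.
  + by rewrite lee_fin mulrn_wge0// sqmod_ge0.
- by move=> x _; rewrite -EFinM lee_fin mulr_ge0 ?sqmod_ge0// mulrn_wge0// sqmod_ge0.
- by apply: measurable_funeM; exact: measurable_sqmod.
- by move=> x _; rewrite -EFinM lee_fin mulr_ge0 ?sqmod_ge0.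
- by apply: measurable_funeM; exact: measurable_sqmod.
Qed.

HB.instance Definition _ := GRing.isSubmodClosed.Build _ _ L2pred L2pred_submod.

Record L2fun := MkL2fun { L2fun_val :> X -> R[i] ; L2funP : L2fun_val \in L2pred }.

HB.instance Definition _ := [isSub for L2fun_val].
HB.instance Definition _ := [Choice of L2fun by <:].
HB.instance Definition _ := [SubChoice_isSubLmodule of L2fun by <:].

Definition ae0 : {pred L2fun} := fun u => `[< {ae mu, forall x, u x = 0} >].

Lemma ae0_zmod : zmod_closed ae0.
Proof.
split; first by apply/asboolP; exact/aeW.
move=> f g /asboolP f0 /asboolP g0; apply/asboolP.
move: f0 g0; apply: filterS2 => x fx gx.
by rewrite [X in X = _](_ : _ = L2fun_val f x - L2fun_val g x)// fx gx subrr.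
Qed.

HB.instance Definition _ := GRing.isZmodClosed.Build _ ae0 ae0_zmod.

(* Classes of square-integrable functions modulo a.e. equality.  The coercion
   L2_to_fun applies a class through a chosen representative, so only a.e.
   assertions about the values of a class are meaningful. *)
Definition L2 := Quotient.quot ae0.
HB.instance Definition _ := GRing.Zmodule.on L2.
HB.instance Definition _ := EqQuotient.on L2.

Definition L2_to_fun (u : L2) : X -> R[i] := repr u.
Coercion L2_to_fun : L2 >-> Funclass.

Lemma L2P (u : L2) : square_integrable u.
Proof. exact/asboolP/L2funP. Qed.

Definition L2class f (hf : square_integrable f) : L2 :=
  \pi_L2 (MkL2fun (asboolT hf : f \in L2pred)).


Lemma L2_eqP (u v : L2fun) :
  {ae mu, forall x, u x = v x} <-> \pi_L2 u = \pi_L2 v.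
Proof.
split=> [uv|/eqP].
  apply/eqP; rewrite -Quotient.idealrBE; apply/asboolP.
  by apply: filterS uv => x uvx; rewrite [LHS](_ : _ = u x - v x)// uvx subrr.
rewrite -Quotient.idealrBE => /asboolP; apply: filterS => x.
by rewrite [X in X = _ -> _](_ : _ = u x - v x)// => /eqP; rewrite subr_eq0 => /eqP.
Qed.

Definition L2_scale (a : R[i]) (u : L2) : L2 := \pi_L2 (a *: repr u).

Lemma pi_scale a (u : L2fun) : \pi_L2 (a *: u) = L2_scale a (\pi_L2 u).
Proof.
apply/L2_eqP.
have /L2_eqP : \pi_L2 (repr (\pi_L2 u)) = \pi_L2 u by rewrite reprK.
apply: filterS => x e; rewrite [LHS](_ : _ = a * u x)//.
by rewrite [RHS](_ : _ = a * repr (\pi_L2 u) x)// e.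
Qed.

Let L2_scaleA a b u : L2_scale a (L2_scale b u) = L2_scale (a * b) u.
Proof. by elim/quotW: u => u; rewrite -(pi_scale b) -!pi_scale scalerA. Qed.

Let L2_scale1 : left_id 1 L2_scale.
Proof. by elim/quotW => u; rewrite -pi_scale scale1r. Qed.

Let L2_scaleDr : right_distributive L2_scale +%R.
Proof.
move=> a; elim/quotW => u; elim/quotW => v.
by rewrite -[X in L2_scale a X]Quotient.pi_add -!pi_scale scalerDr Quotient.pi_add.
Qed.

Let L2_scaleDl u : {morph L2_scale^~ u : a b / a + b}.
Proof.
by elim/quotW: u => u a b; rewrite -!pi_scale scalerDl Quotient.pi_add.
Qed.

HB.instance Definition _ := GRing.Zmodule_isLmodule.Build R[i] L2
  L2_scaleA L2_scale1 L2_scaleDr L2_scaleDl.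

End complex_L2.



Section tensor_power.
Context d (X : measurableType d) (R : realType).
Variable sigma : {sigma_finite_measure set X -> \bar R}.

Definition tcons n (xt : X * n.-tuple X) : n.+1.-tuple X := [tuple of xt.1 :: xt.2].

Lemma measurable_tcons n : measurable_fun [set: X * n.-tuple X] (@tcons n).
Proof. exact: measurable_cons measurable_fst measurable_snd. Qed.

Section step.
Context n (m : {sigma_finite_measure set (n.-tuple X) -> \bar R}).

Definition tensor_step : set (n.+1.-tuple X) -> \bar R :=
  pushforward (sigma \x m)%E (@tcons n).

Let step0 : tensor_step set0 = 0%E.
Proof. by rewrite /tensor_step /pushforward preimage_set0 measure0. Qed.
Let step_ge0 A : (0 <= tensor_step A)%E.
Proof. by rewrite /tensor_step /pushforward; exact: (measure_ge0 (sigma \x m)%E). Qed.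
Let step_sigma : semi_sigma_additive tensor_step.
Proof.
exact: (@measure_semi_sigma_additive _ _ _
  (measure_function_pushforward__canonical__measure_function_Measure
     (sigma \x m)%E (@measurable_tcons n))).
Qed.
HB.instance Definition _ := isMeasure.Build _ _ _ tensor_step step0 step_ge0 step_sigma.

Let step_sfin : sigma_finite [set: n.+1.-tuple X] tensor_step.
Proof.
have /sigma_finiteP[F [TF ndF Foo]] := sigma_finiteT sigma.
have /sigma_finiteP[G [TG ndG Goo]] := sigma_finiteT m.
pose unc (t : n.+1.-tuple X) := (thead t, [tuple of behead t]).
have munc : measurable_fun [set: n.+1.-tuple X] unc.
  by apply/measurable_fun_pair => /=; [exact: measurable_tnth|exact: measurable_behead].
have uncK xt : unc (tcons xt) = xt.
  by case: xt => x t; congr pair; apply/val_inj.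
exists (fun k => unc @^-1` (F k `*` G k)).
  apply/esym; rewrite -subTset => t _.
  have [i _ Fi] : (\bigcup_i F i) (unc t).1 by rewrite -TF.
  have [j _ Gj] : (\bigcup_j G j) (unc t).2 by rewrite -TG.
  exists (maxn i j) => //; split.
    by move: Fi; exact/subsetPset/ndF/leq_maxl.
  by move: Gj; exact/subsetPset/ndG/leq_maxr.
move=> k; have [mF Fk] := Foo k; have [mG Gk] := Goo k; split.
  rewrite -[X in measurable X]setTI; apply: munc => //; exact: measurableX.
rewrite /tensor_step /pushforward -comp_preimage.
have -> : unc \o @tcons n = id by apply/funext => xt; exact: uncK.
rewrite preimage_id.
by rewrite product_measure1E// lte_mul_pinfty// ge0_fin_numE.
Qed.
HB.instance Definition _ := Measure_isSigmaFinite.Build _ _ _ tensor_step step_sfin.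
End step.

(* sigma^{(x) n}; its value on rectangles is tensor_power_box below *)
Fixpoint tensor_power n : {sigma_finite_measure set (n.-tuple X) -> \bar R} :=
  match n with
  | 0 => \d_([tuple] : 0.-tuple X)
  | n'.+1 => tensor_step (tensor_power n')
  end.

End tensor_power.

Section boxes.
Context d (X : measurableType d) (R : realType).
Variable sigma : {sigma_finite_measure set X -> \bar R}.

Definition box n (B : 'I_n -> set X) : set (n.-tuple X) :=
  [set t | forall i, B i (tnth t i)].

Lemma measurable_box n (B : 'I_n -> set X) :
  (forall i, measurable (B i)) -> measurable (box B).
Proof.
move=> mB.
rewrite (_ : box B = \bigcap_(i in [set: 'I_n]) ((fun t => tnth t i) @^-1` B i)); last first.
  by apply/seteqP; split=> t /= h i; [move=> _; exact: h|exact: h].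
apply: fin_bigcap_measurable => // i _.
by rewrite -[X in measurable X]setTI; exact: measurable_tnth.
Qed.

Definition boxes n : set (set (n.-tuple X)) :=
  [set box B | B in [set B | forall i, measurable (B i)]].

Lemma measurable_boxes n : @measurable _ (n.-tuple X) = <<s @boxes n >>.
Proof.
apply/seteqP; split=> A.
  have : measurable_fun setT (id : g_sigma_algebraType (@boxes n) -> n.-tuple X).
    apply/measurable_fun_tnthP => i _ B mB; rewrite setTI.
    apply: sub_sigma_algebra.
    exists (fun j => if j == i then B else setT).
      by move=> j /=; case: ifP.
    apply/seteqP; split=> t /=; first by move=> /(_ i); rewrite eqxx.
    by move=> Bt j; case: eqP => // ->.
  by move=> /(_ measurableT A) /[apply]; rewrite setTI preimage_id.
apply: smallest_sub => [|_ [B mB <-]]; last exact: measurable_box.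
exact: sigma_algebra_measurable.
Qed.

Lemma boxes_setI n : setI_closed (@boxes n).
Proof.
move=> _ _ [B mB <-] [C mC <-]; exists (fun i => B i `&` C i).
  by move=> i; exact: measurableI.
by apply/seteqP; split=> t /= h; [split=> i; case: (h i)|move=> i; case: h].
Qed.

Lemma tensor_power_box n (B : 'I_n -> set X) : (forall i, measurable (B i)) ->
  tensor_power sigma n (box B) = (\prod_(i < n) sigma (B i))%E.
Proof.
elim: n B => [|n IH] B mB.
  rewrite big_ord0 /= /dirac indicE mem_set//.
  by case.
rewrite big_ord_recl /= /tensor_step /pushforward.
rewrite (_ : _ @^-1` _ = B ord0 `*` box (fun i => B (lift ord0 i))); last first.
  apply/seteqP; split=> -[x t] /=.
    by move=> h; split=> [|i]; [exact: (h ord0)|have := h (lift ord0 i); rewrite tnthS].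
  move=> [Bx Bt] i; case: (unliftP ord0 i) => [j ->|->]; last exact: Bx.
  by rewrite tnthS; exact: Bt.
by rewrite product_measure1E// ?IH//; exact: measurable_box.
Qed.

(* (t_1, ..., t_n) |-> (t_{s(1)}, ..., t_{s(n)}) *)
Definition permute_coords n (s : 'S_n) (t : n.-tuple X) : n.-tuple X :=
  [tuple tnth t (s i) | i < n].

Lemma measurable_permute_coords n (s : 'S_n) :
  measurable_fun [set: n.-tuple X] (permute_coords s).
Proof.
apply/measurable_fun_tnthP => i.
rewrite (_ : _ \o _ = fun t => tnth t (s i)); first exact: measurable_tnth.
by apply/funext => t /=; rewrite tnth_mktuple.
Qed.

Lemma tensor_power_perm n (s : 'S_n) (A : set (n.-tuple X)) : measurable A ->
  tensor_power sigma n (permute_coords s @^-1` A) = tensor_power sigma n A.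
Proof.
move=> mA.
have /sigma_finiteP[F [TF ndF Foo]] := sigma_finiteT sigma.
pose pm := measure_function_pushforward__canonical__measure_function_Measure
  (tensor_power sigma n) (measurable_permute_coords s).
have permbox (B : 'I_n -> set X) :
    permute_coords s @^-1` box B = box (fun i => B ((s^-1)%g i)).
  apply/seteqP; split=> t /= h i.
    by have := h ((s^-1)%g i); rewrite tnth_mktuple permKV.
  by rewrite tnth_mktuple; have := h (s i); rewrite permK.
apply: (@measure_unique _ R _ (@boxes n) (fun k => box (fun=> F k)) 
  _ _ _ _ pm (tensor_power sigma n)) => //.
- exact: measurable_boxes.
- exact: boxes_setI.
- by move=> k; exists (fun=> F k) => // i; exact: (Foo k).1.
- rewrite -subTset => t _.
  have h i : exists k, F k (tnth t i).
    by have [k _ Fk] : (\bigcup_k F k) (tnth t i) by [rewrite -TF]; exists k.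
  have [k hk] := choice h.
  exists (\max_(i < n) k i)%N => // i /=.
  by move: (hk i); apply/subsetPset/ndF; exact: leq_bigmax.
- move=> _ [B mB <-]; rewrite /= /pushforward permbox !tensor_power_box//.
  rewrite (reindex_inj (@perm_inj _ s))/=.
  by apply: eq_bigr => i _; rewrite permK.
- move=> k; rewrite /= /pushforward permbox tensor_power_box//; last first.
    by move=> i; exact: (Foo k).1.
  rewrite ltey_eq; apply/orP; left.
  elim/big_ind : _ => //; first by move=> x y; exact: fin_numM.
  by move=> i _; rewrite ge0_fin_numE//; exact: (Foo k).2.
Qed.

End boxes.

Section words.
Variable n : nat.

Lemma adj_lt_l (j : 'I_n.-1) : (j < n)%N.
Proof. exact: leq_trans (ltn_ord j) (leq_pred n). Qed.
Lemma adj_lt_r (j : 'I_n.-1) : (j.+1 < n)%N.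
Proof. by rewrite -ltn_predRL. Qed.
(* With indices counted from 0, adj j exchanges j and j.+1, for j < n.-1. *)
Definition adjl (j : 'I_n.-1) : 'I_n := Ordinal (adj_lt_l j).
Definition adjr (j : 'I_n.-1) : 'I_n := Ordinal (adj_lt_r j).
Definition adj (j : 'I_n.-1) : 'S_n := tperm (adjl j) (adjr j).
(* The composite pi_{j_1} o ... o pi_{j_k} of the word j_1 ... j_k.  The group
   law of 'S_n applies its left factor first, hence the reversed product. *)
Definition word_perm (w : seq 'I_n.-1) : 'S_n :=
  foldr (fun j s => (s * adj j)%g) 1%g w.

Lemma word_perm_cat w1 w2 : word_perm (w1 ++ w2) = (word_perm w2 * word_perm w1)%g.
Proof. by elim: w1 => [|j w IH] /=; rewrite ?mulg1// IH mulgA. Qed.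

Lemma word_perm_tperm (a b : 'I_n) : (a < b)%N -> exists w, word_perm w = tperm a b.
Proof.
case: a b => a ha [b hb] /= ab.
elim: b hb ab => // b IH hb; rewrite ltnS leq_eqVlt => /orP[/eqP ab|ab].
  subst b.
  have h : (a < n.-1)%N by rewrite ltn_predRL.
  exists [:: Ordinal h]; rewrite /= mul1g; congr tperm; exact/val_inj.
have [w wE] := IH (ltnW hb) ab.
have h : (b < n.-1)%N by rewrite ltn_predRL.
exists (Ordinal h :: w ++ [:: Ordinal h]); rewrite /= word_perm_cat wE /= mul1g.
set s := adj (Ordinal h).
have sE : s = tperm (Ordinal (ltnW hb)) (Ordinal hb) by congr tperm; exact/val_inj.
have sV : (s^-1 = s)%g by rewrite sE tpermV.
rewrite -{1}sV -mulgA -/(conjg _ s) tpermJ sE tpermL tpermD//.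
  by rewrite -val_eqE/= gtn_eqF.
by rewrite -val_eqE/= gtn_eqF// ltnW.
Qed.

Lemma word_perm_surj (s : 'S_n) : exists w, s == word_perm w.
Proof.
have [ts -> _] := prod_tpermP s.
elim: ts => [|[a b] ts [w /eqP IH]]; first by exists [::]; rewrite big_nil.
have [v vE] : exists v, word_perm v = tperm a b.
  have [ab|ab|ab] := ltngtP a b; first exact: word_perm_tperm.
    by rewrite tpermC; exact: word_perm_tperm.
  by exists [::]; rewrite (_ : a = b) ?tperm1//; exact/val_inj.
by exists (w ++ v); rewrite big_cons word_perm_cat IH vE.
Qed.

Definition word_of (s : 'S_n) : seq 'I_n.-1 := xchoose (word_perm_surj s).

End words.

Section tensors.
Context d (X : measurableType d) (R : realType).
Variable sigma : {sigma_finite_measure set X -> \bar R}.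

Lemma cmeasurable_comp d' (Y : measurableType d') (phi : Y -> X) (f : X -> R[i]) :
  measurable_fun [set: Y] phi -> cmeasurable [set: X] f ->
  cmeasurable [set: Y] (fun y => f (phi y)).
Proof.
move=> mphi [rf jf].
by split; [exact: (measurableT_comp rf)|exact: (measurableT_comp jf)].
Qed.

Definition tensor_fun n (f : 'I_n -> X -> R[i]) (t : n.-tuple X) : R[i] :=
  \prod_(i < n) f i (tnth t i).

Lemma measurable_tensor n (f : 'I_n -> X -> R[i]) :
  (forall i, cmeasurable [set: X] (f i)) ->
  cmeasurable [set: n.-tuple X] (tensor_fun f).
Proof.
move=> mf; rewrite /tensor_fun; elim: (index_enum _) => [|i r IH].
  by under eq_fun do rewrite big_nil; exact: cmeasurable_cst.
under eq_fun do rewrite big_cons; apply: cmeasurableM => //.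
exact: (cmeasurable_comp (measurable_tnth i)).
Qed.

Lemma integral_tensor_power n (g : 'I_n -> X -> R) :
  (forall i, measurable_fun [set: X] (g i)) -> (forall i x, 0 <= g i x) ->
  (\int[tensor_power sigma n]_t (\prod_(i < n) g i (tnth t i))%:E =
   \prod_(i < n) \int[sigma]_x (g i x)%:E)%E.
Proof.
elim: n g => [|n IH] g mg g0.
  rewrite big_ord0; under eq_integral do rewrite big_ord0.
  by rewrite integral_cst//= diracT mule1.
have mP k (h : 'I_k -> X -> R) : (forall i, measurable_fun [set: X] (h i)) ->
    measurable_fun [set: k.-tuple X] (fun t => (\prod_(i < k) h i (tnth t i))%:E).
  move=> mh; apply/measurable_EFinP; elim: (index_enum _) => [|i r IHr].
    by under eq_fun do rewrite big_nil; exact: measurable_cst.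
  under eq_fun do rewrite big_cons; apply: measurable_funM => //.
  exact: (measurableT_comp (mh i) (measurable_tnth i)).
rewrite /= /tensor_step (ge0_integral_pushforward (@measurable_tcons _ X n)
  (sigma \x tensor_power sigma n)%E)//.
- rewrite preimage_setT fubini_tonelli1.
  + rewrite big_ord_recl -ge0_integralZr//.
    * apply: eq_integral => x _; rewrite /fubini_F /=.
      rewrite (eq_integral (fun t => (g ord0 x)%:E *
          (\prod_(i < n) g (lift ord0 i) (tnth t i))%:E)%E); last first.
        move=> t _; rewrite big_ord_recl EFinM /tcons; congr (_ * EFin _)%E.
        by apply: eq_bigr => i _; rewrite tnthS.
      rewrite ge0_integralZl ?lee_fin//.
      - by rewrite -IH.
      - exact: (mP n (fun i => g (lift ord0 i))).
      - by move=> t _; rewrite lee_fin prodr_ge0.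
    * exact/measurable_EFinP.
    * by move=> x _; rewrite lee_fin.
    * by apply: prode_ge0 => i _; apply: integral_ge0 => x _; rewrite lee_fin.
  + apply: (measurableT_comp (mP _ g mg)); exact: measurable_tcons.
  + by move=> x; rewrite lee_fin prodr_ge0.
- exact: mP.
- by move=> t _; rewrite lee_fin prodr_ge0.
Qed.

Lemma tensor_square_integrable n (f : 'I_n -> X -> R[i]) :
  (forall i, square_integrable sigma (f i)) ->
  square_integrable (tensor_power sigma n) (tensor_fun f).
Proof.
move=> fL2; split; first by apply: measurable_tensor => i; exact: (fL2 i).1.
have sqprod t : sqmod (tensor_fun f t) = \prod_(i < n) sqmod (f i (tnth t i)).
  by apply: big_morph => [|]; [exact: sqmodM|rewrite /sqmod/= expr0n/= expr1n addr0].
under eq_integral do rewrite sqprod.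
rewrite (integral_tensor_power (g := fun i x => sqmod (f i x))).
- rewrite ltey_eq; apply/orP; left.
  elim/big_ind : _ => //; first by move=> x y; exact: fin_numM.
  move=> i _; rewrite ge0_fin_numE; first exact: (fL2 i).2.
  by apply: integral_ge0 => x _; rewrite lee_fin sqmod_ge0.
- by move=> i; apply/measurable_EFinP/measurable_sqmod; exact: (fL2 i).1.
- by move=> i x; exact: sqmod_ge0.
Qed.

Definition tensor n (f : 'I_n -> L2 sigma) : L2 (tensor_power sigma n) :=
  L2class (tensor_square_integrable (fun i => L2P (f i))).

End tensors.

Notation borel T := (g_sigma_algebraType (@open T)).

Definition polish (R : realType) (T : topologicalType) : Prop :=
  (exists2 D : set T, countable D & dense D) /\
  exists dist : T -> T -> R,
    [/\ forall x y, dist x y = 0 <-> x = y,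
        forall x y, dist x y = dist y x,
        forall x y z, dist x z <= dist x y + dist y z,
        forall x, nbhs x =
          filter_from [set e | 0 < e] (fun e : R => [set y | dist x y < e])
      & forall u : nat -> T,
          (forall e : R, 0 < e -> exists N, forall k l, (N <= k)%N -> (N <= l)%N ->
             dist (u k) (u l) < e) ->
          exists x : T, u @ \oo --> x].

Section radon.
Context (R : realType) (T : ptopologicalType).
Variable sigma : {measure set (borel T) -> \bar R}.

Definition radon : Prop :=
  (forall K : set T, compact K -> (sigma K < +oo)%E) /\
  (forall B : set (borel T), measurable B ->
     sigma B = ereal_sup [set sigma K | K in
       [set K : set T | compact K /\ K `<=` B]]).

Definition nonatomic : Prop :=
  forall B : set (borel T), measurable B -> (0 < sigma B)%E ->
    exists C : set (borel T),
      [/\ measurable C, C `<=` B, (0 < sigma C)%E & (sigma C < sigma B)%E].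

Hypothesis polishT : polish R T.
Hypothesis lcT : locally_compact [set: T].
Hypothesis radonS : radon.

Lemma radon_sigma_finite : sigma_finite [set: borel T] sigma.
Proof.
have [[D cD dD] [dist [d0 dC dD3 dN _]]] := polishT.
pose ball q (n : nat) := [set y : T | dist q y < n.+1%:R^-1].
pose good q n (K : set T) := [/\ compact K, closed K & ball q n `<=` K].
pose C q n : set T := if pselect (exists K, good q n K) is left h
  then projT1 (cid h) else set0.
have CP q n : compact (C q n) /\ closed (C q n).
  rewrite /C; case: pselect => [h|_]; last by split; [exact: compact0|exact: closed0].
  by case: (cid h) => K [].
have [D0|[e]] := pfcard_geP cD.
  exfalso; have T0 : [set: T] !=set0 by exists point.
  by have := dD _ T0 openT; rewrite D0 setI0 => -[].
pose F k : set (borel T) := if unpickle k is Some (i, n) then C (e i) n else set0.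
exists F.
  apply/esym; rewrite -subTset => x _.
  have [K] := @lcT x I; rewrite withinET => Kx [cK clK].
  have [r r0 rK] : filter_from [set r : R | 0 < r] (fun r => [set y | dist x y < r]) K.
    by rewrite -dN.
  have [n nr] : exists n : nat, n.+1%:R^-1 < r / 2.
    have [|n nr] := @ltr_add_invr R 0 (r / 2); first by rewrite divr_gt0.
    by exists n; rewrite add0r in nr.
  have n0 : 0 < (n.+1%:R^-1 : R) by rewrite invr_gt0.
  pose O := interior [set y | dist x y < n.+1%:R^-1].
  have Ox : O x by rewrite /O /interior /= dN; exists n.+1%:R^-1.
  have [q [Oq Dq]] : O `&` D !=set0.
    by apply: dD; [exists x|exact: open_interior].
  have xq : dist x q < n.+1%:R^-1 by exact: (interior_subset Oq).
  have [i _ iq] := 'surj_e Dq.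
  have gq : exists K, good q n K.
    exists K; split=> // y qy; apply: rK => /=.
    rewrite (le_lt_trans (dD3 _ q _))// (splitr r) ltrD//; exact: lt_trans nr.
  exists (pickle (i, n)) => //; rewrite /F pickleK iq /C.
  case: pselect => // h; case: (cid h) => K' [_ _] /=; apply.
  by rewrite /ball /= dC.
move=> k; rewrite /F; case: (unpickle k) => [[i n]|]; last first.
  by split=> //; rewrite measure0 ltry.
have [cC clC] := CP (e i) n; split; last exact: radonS.1.
rewrite -[C _ _]setCK; apply: measurableC; apply: sub_sigma_algebra.
exact: closed_openC.
Qed.
End radon.

Section Q_symmetrization.
Context d (X : measurableType d) (R : realType).

(* Q is a total function of which only the values off A are constrained.  X * X
   carries the product sigma-algebra, which is the Borel one when X is a Polish
   space with its Borel sigma-algebra. *)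
Record Q_kernel (mu : set X -> \bar R) (A : set (X * X)) (Q : X * X -> R[i]) : Prop := {
  exc_measurable : measurable A ;
  exc_sym : forall s t, A (s, t) -> A (t, s) ;
  exc_diag : forall t, A (t, t) ;
  exc_null : (mu \x mu)%E A = 0%E ;
  Q_measurable : cmeasurable (~` A) Q ;
  Q_norm : forall st, ~ A st -> `|Q st| = 1 ;
  Q_hermitian : forall s t, ~ A (s, t) -> Q (s, t) = ((Q (t, s))^*)%C }.

Variables (sigma : {sigma_finite_measure set X -> \bar R}).
Variables (A : set (X * X)) (Q : X * X -> R[i]).
Hypothesis kerQ : Q_kernel sigma A Q.

(* Q is only specified off A; its extension by 0 is an everywhere defined
   measurable representative of its a.e. class. *)
Definition Qext (st : X * X) : R[i] := if st \in A then 0 else Q st.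

Lemma measurable_Qext : cmeasurable [set: X * X] Qext.
Proof.
have [rQ jQ] := Q_measurable kerQ.
have mA := exc_measurable kerQ.
have mB : @measurable _ (X * X)%type (~` A) by exact: measurableC.
split.
  apply: (@eq_measurable_fun _ _ _ _ _ ((fun st => complex.Re (Q st)) \_ (~` A))).
    by move=> x _; rewrite /Qext patchE in_setC; case: (x \in A).
  exact/(measurable_restrictT _ mB).
apply: (@eq_measurable_fun _ _ _ _ _ ((fun st => complex.Im (Q st)) \_ (~` A))).
  by move=> x _; rewrite /Qext patchE in_setC; case: (x \in A).
exact/(measurable_restrictT _ mB).
Qed.

Lemma sqmod_Qext st : sqmod (Qext st) <= 1.
Proof.
rewrite /Qext; case: ifPn => [_|]; first by rewrite /sqmod /= expr0n addr0.
move=> /negP stA; have nA : ~ A st by move=> ?; apply: stA; rewrite inE.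
by rewrite -lecR [(sqmod _)%:C%C]add_Re2_Im2 (Q_norm kerQ nA) expr1n.
Qed.

Variable n : nat.
Local Notation mun := (tensor_power sigma n).

Definition Psi_fun (j : 'I_n.-1) (f : n.-tuple X -> R[i]) (t : n.-tuple X) : R[i] :=
  Qext (tnth t (adjl j), tnth t (adjr j)) * f (permute_coords (adj j) t).

Lemma Psi_square_integrable j f :
  square_integrable mun f -> square_integrable mun (Psi_fun j f).
Proof.
move=> [mf If].
have mfp : cmeasurable [set: n.-tuple X] (fun t => f (permute_coords (adj j) t)).
  exact: (cmeasurable_comp (measurable_permute_coords _)).
have mP : cmeasurable [set: n.-tuple X] (Psi_fun j f).
  apply: cmeasurableM => //.
  apply: (@cmeasurable_comp _ _ _ _ _ (fun t => (tnth t (adjl j), tnth t (adjr j)))).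
    by apply/measurable_fun_pair => /=; exact: measurable_tnth.
  exact: measurable_Qext.
split=> //.
apply: (@le_lt_trans _ _ (\int[mun]_t (sqmod (f (permute_coords (adj j) t)))%:E)%E).
  apply: ge0_le_integral => //.
  - by move=> t _; rewrite lee_fin sqmod_ge0.
  - exact: measurable_sqmod.
  - exact: measurable_sqmod.
  - by move=> t _; rewrite lee_fin sqmodM ler_piMl// ?sqmod_ge0// sqmod_Qext.
apply: le_lt_trans If.
pose pm := measure_function_pushforward__canonical__measure_function_Measure
  mun (measurable_permute_coords (adj j)).
rewrite -[X in (_ <= X)%E](@eq_measure_integral _ _ _ _ mun pm); last first.
  by move=> B mB _; exact: tensor_power_perm.
rewrite /= (ge0_integral_pushforward (measurable_permute_coords (adj j)))//.
- exact: measurable_sqmod.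
- by move=> t _; rewrite lee_fin sqmod_ge0.
Qed.

Definition Psi (j : 'I_n.-1) (f : L2 mun) : L2 mun :=
  L2class (Psi_square_integrable j (L2P f)).

(* Psi does not depend on the representative *)
Lemma PsiE j (f : n.-tuple X -> R[i]) (fL2 : square_integrable mun f) :
  Psi j (L2class fL2) = L2class (Psi_square_integrable j fL2).
Proof.
apply/L2_eqP.
have /L2_eqP : \pi_(L2 mun) (repr (L2class fL2)) = L2class fL2 by rewrite reprK.
move=> [N [mN N0 sN]].
exists (permute_coords (adj j) @^-1` N); split.
- by rewrite -[X in measurable X]setTI; exact: measurable_permute_coords.
- by rewrite -N0; exact: tensor_power_perm.
- move=> t /= h; apply: sN => /= e; apply: h.
  by rewrite /Psi_fun /L2_to_fun e.
Qed.

Definition Psi_word (w : seq 'I_n.-1) (f : L2 mun) : L2 mun := foldr Psi f w.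

(* word_of s is some factorisation of s into adjacent transpositions *)
Definition Psi_perm (s : 'S_n) (f : L2 mun) : L2 mun := Psi_word (word_of s) f.
Definition Qsymmetrization (f : L2 mun) : L2 mun :=
  (n`!%:R)^-1 *: \sum_(s : 'S_n) Psi_perm s f.
Definition circledast (f : 'I_n -> L2 sigma) : L2 mun := Qsymmetrization (tensor f).

Definition Qprod (s : 'S_n) (t : n.-tuple X) : R[i] :=
  \prod_(i < n) \prod_(j < n | (i < j)%N && (s j < s i)%N) Q (tnth t i, tnth t j).

End Q_symmetrization.

Section radon_measure.
Context (R : realType) (T : ptopologicalType) (polishT : polish R T)
  (lcT : locally_compact [set: T]).
Variable sigma : {measure set (borel T) -> \bar R}.
Hypothesis radon_sigma : radon sigma.

(* sigma itself; the discarded arguments record why it is sigma-finite *)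
Definition radon_fun of polish R T & locally_compact [set: T] & radon sigma :
  set (borel T) -> \bar R := sigma.

Local Notation m := (radon_fun polishT lcT radon_sigma).
HB.instance Definition _ := isMeasure.Build _ _ _ m
  (measure0 sigma) (measure_ge0 sigma)
  (@measure_semi_sigma_additive _ _ _ sigma).
HB.instance Definition _ := Measure_isSigmaFinite.Build _ _ _ m
  (radon_sigma_finite polishT lcT radon_sigma).

Definition radon_measure : {sigma_finite_measure set (borel T) -> \bar R} := m.
End radon_measure.

(* Main.v *)
Require Import Defs.
From mathcomp Require Import all_boot all_order all_algebra fingroup perm.
From mathcomp Require Import generic_quotient ring_quotient complex.
From mathcomp Require Import all_classical all_reals all_analysis.
From mathcomp Require Import zify.
Import Order.TTheory GRing.Theory Num.Theory.
Import numFieldNormedType.Exports.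

(** Applying [Psi j] multiplies by a value of Q and composes with the adjacent
    transposition [adj j], so [Psi_word w f] has the form
    c(t) f(t_{pi(1)}, ..., t_{pi(n)}) with pi the permutation of the word w.
    The point is that c = Q_{pi^-1}: it depends on pi only, and not on w
    ([ae_Psi_word]).  This comes from the cocycle identity
      Q(t_j, t_{j+1}) Q_s(t o pi_j) = Q_{s o pi_j}(t),
    [Qprod_adj].  Indeed pi_j preserves the order of every pair of indices but
    (j, j+1), so the inversions of s and of s o pi_j correspond, except that
    exactly one of the two permutations inverts (j, j+1).  If it is s o pi_j,
    the new factor Q(t_j, t_{j+1}) is the missing one; if it is s, the new
    factor cancels Q(t_{j+1}, t_j), because Q is Hermitian and unimodular.

    Since the sum defining the symmetrization runs over the whole group, the
    substitution pi -> pi^-1 turns Q_{pi^-1}(t) f(t o pi) into the summand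
    Q_pi(t) f(t o pi^-1) of the formula ([ae_Qsymmetrization]).  For a tensor
    product, permuting the arguments amounts to permuting the factors
    ([tensor_fun_permute]), which gives [ae_circledast].

    The cancellation needs Q at pairs (t_i, t_j) outside the exceptional set A.
    Almost every tuple has all its pairs outside A ([ae_generic]): by invariance
    of the product measure under permutations of coordinates it is enough to
    consider the first two coordinates, where Fubini applies
    ([tensor_power_first2]).  *)

Set Implicit Arguments.
Unset Strict Implicit.
Unset Printing Implicit Defensive.

Local Open Scope classical_set_scope.
Local Open Scope ring_scope.
Local Open Scope quotient_scope.

(** * Adjacent transpositions and the cocycle identity *)

Lemma val_adj n (j : 'I_n.-1) (x : 'I_n) :
  adj j x =
  (if x == j :> nat then j.+1 else if x == j.+1 :> nat then j : nat else x)
  :> nat.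
Proof.
rewrite /adj; case: tpermP => [->|->|/eqP xl /eqP xr] /=.
- by rewrite eqxx.
- by rewrite eqxx gtn_eqF.
- by move: xl xr; rewrite -!val_eqE /= => /negPf -> /negPf ->.
Qed.

Lemma ltn_adj n (j : 'I_n.-1) (x y : 'I_n) :
  (x, y) != (adjl j, adjr j) -> (x, y) != (adjr j, adjl j) ->
  (adj j x < adj j y)%N = (x < y)%N.
Proof.
rewrite !xpair_eqE -!val_eqE /= !val_adj.
move: (x : nat) (y : nat) (j : nat) => a b c.
by do 4! (case: eqP => ?); lia.
Qed.

Lemma permute_coordsM d (X : measurableType d) n (s u : 'S_n)
    (t : n.-tuple X) :
  permute_coords u (permute_coords s t) = permute_coords (u * s)%g t.
Proof. by apply: eq_from_tnth => i; rewrite !tnth_mktuple permM. Qed.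

Section cocycle.
Context d (X : measurableType d) (R : realType).
Variables (mu : set X -> \bar R) (A : set (X * X)) (Q : X * X -> R[i]).
Hypothesis kerQ : Q_kernel mu A Q.

Definition generic n (t : n.-tuple X) : Prop :=
  forall i j : 'I_n, i != j -> ~ A (tnth t i, tnth t j).

Lemma Q_mulC s t : ~ A (s, t) -> Q (s, t) * Q (t, s) = 1.
Proof.
move=> st; have ts : ~ A (t, s) by move=> /(exc_sym kerQ).
by rewrite (Q_hermitian kerQ st) mulrC -normCK (Q_norm kerQ ts) expr1n.
Qed.

(** A single product over all pairs of indices can be reindexed by letting a
    permutation act on both components. *)
Lemma QprodE n (s : 'S_n) (t : n.-tuple X) :
  Qprod Q s t = \prod_(p : 'I_n * 'I_n)
    (if (p.1 < p.2)%N && (s p.2 < s p.1)%N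
     then Q (tnth t p.1, tnth t p.2) else 1).
Proof. by rewrite /Qprod pair_big_dep /= big_mkcond. Qed.

(** The group law of the permutations applies its left factor first, so that
    [adj j * s] is the composite s o pi_j.  The two products agree factor by
    factor outside the pairs (j, j+1) and (j+1, j). *)
Lemma Qprod_adj n (s : 'S_n) (j : 'I_n.-1) (t : n.-tuple X) : generic t ->
  Q (tnth t (adjl j), tnth t (adjr j)) * Qprod Q s (permute_coords (adj j) t)
  = Qprod Q (adj j * s)%g t.
Proof.
move=> gt.
have lr : adjl j != adjr j by rewrite -val_eqE /= ltn_eqF.
have aK : involutive (adj j) by exact: tpermK.
rewrite !QprodE (reindex_inj (h := fun p => (adj j p.1, adj j p.2))) /=;
  last by move=> [x y] [x' y'] [/perm_inj -> /perm_inj ->].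
have splitlr (F : 'I_n * 'I_n -> R[i]) : \prod_p F p =
    F (adjl j, adjr j) * (F (adjr j, adjl j) *
    \prod_(p | (p != (adjl j, adjr j)) && (p != (adjr j, adjl j))) F p).
  rewrite (bigD1 (adjl j, adjr j)) //= (bigD1 (adjr j, adjl j)) //=.
  by rewrite xpair_eqE negb_and eq_sym lr.
rewrite !splitlr /= !permM !tnth_mktuple !aK.
rewrite !mulrA; congr (_ * _); last first.
  apply: eq_bigr => -[x y] /= /andP[xyl xyr].
  by rewrite !permM !tnth_mktuple !aK ltn_adj.
have <- : adjr j = adj j (adjl j) by rewrite /adj tpermL.
have <- : adjl j = adj j (adjr j) by rewrite /adj tpermR.
have -> : (adjl j < adjr j)%N = true by exact: ltnSn.
have -> : (adjr j < adjl j)%N = false by rewrite ltnNge ltnW.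
have : s (adjr j) != s (adjl j) by rewrite (inj_eq perm_inj) eq_sym.
rewrite -val_eqE /= => srl; rewrite !mulr1.
(* Either s inverts (j, j+1), and two factors cancel, or s o pi_j does. *)
case: ltngtP srl => //= _ _; first by rewrite Q_mulC //; exact: gt.
by rewrite mulr1.
Qed.

End cocycle.

(** * Null sets of the product measure *)

Section null_sets.
Context d (X : measurableType d) (R : realType).
Variable sigma : {sigma_finite_measure set X -> \bar R}.

(** The set is the product of A with the full space of the remaining
    coordinates.  That space may have infinite measure, in which case the
    conclusion rests on 0 * oo = 0. *)
Lemma tensor_power_first2 n (A : set (X * X)) : measurable A ->
  (sigma \x sigma)%E A = 0%E ->
  tensor_power sigma n.+2
    [set t | A (tnth t ord0, tnth t (lift ord0 ord0))] = 0%E.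
Proof.
move=> mA A0.
rewrite /= /tensor_step /pushforward.
transitivity
    (\int[sigma]_x ((sigma \o xsection A) x * tensor_power sigma n setT))%E.
  apply: eq_integral => x _ /=.
  rewrite -[RHS]product_measure1E //; last exact: measurable_xsection.
  rewrite /tensor_step /pushforward; congr (product_measure1 _ _ _).
  by apply/seteqP; split => -[y u]; rewrite /xsection /= !inE //; case.
rewrite ge0_integralZr //; last exact: measurable_fun_xsection.
by rewrite -/(product_measure1 sigma sigma A) A0 mul0e.
Qed.

Lemma ae_permute_coords n (s : 'S_n) (P : n.-tuple X -> Prop) :
  {ae tensor_power sigma n, forall t, P t} ->
  {ae tensor_power sigma n, forall t, P (permute_coords s t)}.
Proof.
move=> [N [mN N0 sN]]; exists (permute_coords s @^-1` N); split.
- by rewrite -[X in measurable X]setTI; exact: measurable_permute_coords.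
- by rewrite -N0; exact: tensor_power_perm.
- by move=> t /= h; exact: sN.
Qed.

Lemma ae_coords n (i j : 'I_n) (A : set (X * X)) : measurable A ->
  (sigma \x sigma)%E A = 0%E -> i != j ->
  {ae tensor_power sigma n, forall t, ~ A (tnth t i, tnth t j)}.
Proof.
case: n i j => [[]//|[|n]] i j; first by rewrite !ord1 eqxx.
move=> mA A0 ij.
have [s si sj] : exists2 s : 'S_n.+2, s ord0 = i & s (lift ord0 ord0) = j.
  have k0 : tperm ord0 i j != ord0.
    by rewrite -(inj_eq (@perm_inj _ (tperm ord0 i))) tpermK tpermL eq_sym.
  (* The second factor sends 0 to i; the first one prepares the preimage of j
     under it, and fixes 0. *)
  exists (tperm (lift ord0 ord0) (tperm ord0 i j) * tperm ord0 i)%g.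
    by rewrite permM (tpermD _ k0) ?tpermL.
  by rewrite permM tpermL tpermK.
pose B := [set t : n.+2.-tuple X | A (tnth t ord0, tnth t (lift ord0 ord0))].
have aeB : {ae tensor_power sigma n.+2, forall t, ~ B t}.
  exists B; split; [|exact: tensor_power_first2|by move=> t /= /contrapT].
  rewrite -[B]setTI.
  have := measurable_fun_pair (measurable_tnth ord0)
    (measurable_tnth (lift ord0 ord0)).
  by apply.
apply: filterS (ae_permute_coords s aeB) => t.
by rewrite /B /= !tnth_mktuple si sj.
Qed.

Lemma ae_generic (A : set (X * X)) (Q : X * X -> R[i]) n :
  Q_kernel sigma A Q -> {ae tensor_power sigma n, forall t, generic A t}.
Proof.
move=> kerQ; apply: filter_forall => i; apply: filter_forall => j.
have [->|ij] := eqVneq i j; first by apply: aeW => t /eqP.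
have := ae_coords (exc_measurable kerQ) (exc_null kerQ) ij.
by apply: filterS.
Qed.

End null_sets.

(** * Pointwise values of classes of square-integrable functions *)

Section L2_representatives.
Context d (X : measurableType d) (R : realType).
Variable mu : {measure set X -> \bar R}.

Lemma ae_repr_pi (u : L2fun mu) :
  {ae mu, forall x, L2_to_fun (\pi_(L2 mu) u) x = u x}.
Proof. by apply/L2_eqP; rewrite reprK. Qed.

Lemma ae_L2class f (hf : square_integrable mu f) :
  {ae mu, forall x, L2class hf x = f x}.
Proof. exact: ae_repr_pi. Qed.

Lemma ae_L2D (u v : L2 mu) : {ae mu, forall x, L2_to_fun (u + v) x = u x + v x}.
Proof.
have -> : u + v = \pi_(L2 mu) (repr u + repr v).
  by rewrite Quotient.pi_add !reprK.
exact: ae_repr_pi.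
Qed.

Lemma ae_L2Z a (u : L2 mu) : {ae mu, forall x, L2_to_fun (a *: u) x = a * u x}.
Proof. exact: ae_repr_pi. Qed.

Lemma ae_L2sum (I : Type) (r : seq I) (u : I -> L2 mu) :
  {ae mu, forall x, L2_to_fun (\sum_(i <- r) u i) x = \sum_(i <- r) u i x}.
Proof.
elim: r => [|i r IH].
  apply: filterS (ae_L2Z 0 (0 : L2 mu)) => x.
  by rewrite scale0r mul0r !big_nil.
rewrite big_cons.
apply: filterS2 IH (ae_L2D (u i) (\sum_(k <- r) u k)) => x IH ->.
by rewrite big_cons IH.
Qed.

End L2_representatives.

(** * The Q-symmetrization *)

(** The factor attached to position i is evaluated at coordinate s^-1(i), so
    coordinate i is fed to factor s(i). *)
Lemma tensor_fun_permute d (X : measurableType d) (R : realType) n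
    (f : 'I_n -> X -> R[i]) (s : 'S_n) (t : n.-tuple X) :
  tensor_fun f (permute_coords s^-1%g t) = tensor_fun (fun i => f (s i)) t.
Proof.
rewrite /tensor_fun (reindex_inj (@perm_inj _ s)) /=.
by apply: eq_bigr => i _; rewrite tnth_mktuple permK.
Qed.

Section symmetrization.
Context d (X : measurableType d) (R : realType).
Variable sigma : {sigma_finite_measure set X -> \bar R}.
Variables (A : set (X * X)) (Q : X * X -> R[i]).
Hypothesis kerQ : Q_kernel sigma A Q.

(** Composition of operators reverses the order in which coordinates are
    permuted: f ends up at t o pi, and the accumulated coefficient belongs to
    the inverse permutation. *)
Lemma ae_Psi_word n (w : seq 'I_n.-1) (f : L2 (tensor_power sigma n)) :
  {ae tensor_power sigma n, forall t, Psi_word kerQ w f t =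
    Qprod Q (word_perm w)^-1%g t * f (permute_coords (word_perm w) t)}.
Proof.
elim: w => [|j w IH] /=.
  apply: aeW => t; rewrite invg1 (_ : Qprod _ _ _ = 1) ?mul1r.
    congr (L2_to_fun f _).
    by apply: eq_from_tnth => i; rewrite tnth_mktuple perm1.
  by rewrite QprodE big1 // => -[x y] _ /=; rewrite !perm1; case: ltngtP.
have PsiE :=
  ae_L2class (Psi_square_integrable kerQ j (L2P (Psi_word kerQ w f))).
apply: filterS3 (ae_generic n kerQ) (ae_permute_coords (adj j) IH) PsiE.
move=> t gt IHt; rewrite -/(Psi kerQ j _) => ->.
rewrite /Psi_fun IHt permute_coordsM mulrA; congr (_ * _).
rewrite /Qext memNset; last by apply: gt; rewrite -val_eqE /= ltn_eqF.
by rewrite (Qprod_adj kerQ) // invMg tpermV.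
Qed.

Lemma ae_Psi_perm n (s : 'S_n) (f : L2 (tensor_power sigma n)) :
  {ae tensor_power sigma n, forall t, Psi_perm kerQ s f t =
    Qprod Q s^-1%g t * f (permute_coords s t)}.
Proof.
have sE : word_perm (word_of s) = s.
  by rewrite -(eqP (xchooseP (word_perm_surj s))).
by have := ae_Psi_word (word_of s) f; rewrite sE.
Qed.

Lemma ae_Qsymmetrization n (f : L2 (tensor_power sigma n)) :
  {ae tensor_power sigma n, forall t, Qsymmetrization kerQ f t =
    (n`!%:R)^-1 *
    \sum_(p : 'S_n) Qprod Q p t * f (permute_coords (p^-1)%g t)}.
Proof.
have Psis : {ae tensor_power sigma n, forall t, forall s : 'S_n,
    Psi_perm kerQ s f t = Qprod Q s^-1%g t * f (permute_coords s t)}.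
  by apply: filter_forall => s; exact: ae_Psi_perm.
apply: filterS3 (ae_L2Z (n`!%:R)^-1 (\sum_(s : 'S_n) Psi_perm kerQ s f))
  (ae_L2sum (index_enum _) (fun s : 'S_n => Psi_perm kerQ s f)) Psis.
move=> t -> -> Psit; congr (_ * _).
rewrite (reindex_inj invg_inj) /=; apply: eq_bigr => s _.
by rewrite Psit invgK.
Qed.

Lemma ae_circledast n (f : 'I_n -> L2 sigma) :
  {ae tensor_power sigma n, forall t, circledast kerQ f t =
    (n`!%:R)^-1 *
    \sum_(p : 'S_n) Qprod Q p t * tensor (fun i => f (p i)) t}.
Proof.
have tensorE (g : 'I_n -> L2 sigma) :
    {ae tensor_power sigma n, forall t, tensor g t = tensor_fun g t}.
  exact: ae_L2class.
have tensors : {ae tensor_power sigma n, forall t, forall s : 'S_n,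
    tensor f (permute_coords s^-1%g t) = tensor (fun i => f (s i)) t}.
  apply: filter_forall => s.
  apply: filterS2 (ae_permute_coords s^-1%g (tensorE f))
    (tensorE (fun i => f (s i))) => t -> ->.
  exact: tensor_fun_permute.
apply: filterS2 (ae_Qsymmetrization (tensor f)) tensors => t.
rewrite /circledast => -> ft; congr (_ * _); apply: eq_bigr => s _.
by rewrite ft.
Qed.

End symmetrization.

Unset Implicit Arguments.

Theorem proposition2p8 (R : realType) (T : ptopologicalType)
    (polishT : polish R T) (lcT : locally_compact [set: T])
    (sigma : {measure set (borel T) -> \bar R})
    (radon_sigma : radon sigma) (nonatomic_sigma : nonatomic sigma)
    (A : set (borel T * borel T)) (Q : borel T * borel T -> R[i])
    (kerQ : Q_kernel sigma A Q) (n : nat) (n_ge2 : (2 <= n)%N) :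
  let s := radon_measure polishT lcT radon_sigma in
  (forall f : L2 (tensor_power s n),
    {ae tensor_power s n, forall t,
      Qsymmetrization (sigma := s) kerQ f t =
      (n`!%:R)^-1 *
      \sum_(p : 'S_n) Qprod Q p t * f (permute_coords (p^-1)%g t)}) /\
  (forall f : 'I_n -> L2 s,
    {ae tensor_power s n, forall t,
      circledast (sigma := s) kerQ f t =
      (n`!%:R)^-1 *
      \sum_(p : 'S_n) Qprod Q p t * tensor (fun i => f (p i)) t}).
Proof. by split; [exact: ae_Qsymmetrization|exact: ae_circledast]. Qed.
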